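(* Let $\alpha,D>0$ and suppose that the system $\dot V(t)=-A(t,t_p)V(t)$, $t\ge0$, admits a predefined-time $\mu$ contraction with a positive function $\mu_{\alpha,D}(t,\tau)$ satisfying (B1)–(B3), i.e. its evolution operator satisfies $\|\Phi(t,\tau)\|\le\mu_{\alpha,D}(t,\tau)$ for all $t\ge\tau\ge0$. Let $\widetilde A(t)$, $t\ge 0$, be an $n\times n$ matrix function with $\|\widetilde A(t)\|\le\delta$ for all $t\ge 0$, where $\delta\le\alpha/D$. Then the system $$\dot V(t)=-A(t,t_p)V(t)+\widetilde A(t)V(t),\qquad t\ge0,$$ also admits a predefined-time $\mu$ contraction, i.e. $$\|\Gamma(t,\tau)\|\le\mu_{\alpha-\delta D,D}(t,\tau)\qquad (t\ge\tau\ge 0),$$ where $\Gamma(t,\tau)$ is the evolution operator associated to this perturbed system.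
   Context: Here $V(t)\in\mathbb{R}^n$, $A(t,t_p)$ is an $n\times n$ matrix function, $t_p>0$ is fixed, and $\|\cdot\|$ is the Euclidean norm and the induced operator norm. The evolution operator $\Phi(t,\tau)$ (resp. $\Gamma(t,\tau)$) of a linear system is defined by $V(t)=\Phi(t,\tau)V(\tau)$ (resp. $V(t)=\Gamma(t,\tau)V(\tau)$) for all its solutions $V$. The conditions on the positive function $\mu_{\alpha,D}(t,\tau)$ are: (B1) $\lim_{t\to+\infty}\mu_{\alpha,D}(t,\tau)=0$, and $\mu_{\alpha,D}(t,\tau)$ is decreasing in $t$ and in $\alpha$ and increasing in $D$; (B2) $\alpha$ is sufficiently large that $\lim_{t\to t_p^+}\mu_{\alpha,D}(t,0)\le\epsilon$, where $\epsilon>0$ is a (small) number; (B3) with $\mu(t,\tau):=\mu_{1,1}(t,\tau)$, one has $\mu_{\alpha,D}(t,\tau)=D\,\mu^{\alpha}(t,\tau)$, $\mu(t,\tau)\mu(\tau,s)=\mu(t,s)$, and $\frac{\partial\mu(0,t)}{\partial t}\cdot\mu^{-1}(0,t)\ge1$. In particular $\mu_{\alpha-\delta D,D}(t,\tau)=D\,\mu^{\alpha-\delta D}(t,\tau)$. *)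

(* Defs.v *)
From HB Require Import structures.
From mathcomp Require Import all_boot all_order all_algebra.
From mathcomp Require Import all_classical all_reals all_analysis.

Set Implicit Arguments.
Unset Strict Implicit.
Unset Printing Implicit Defensive.

Import Order.TTheory GRing.Theory Num.Theory.
Import numFieldNormedType.Exports.

Local Open Scope classical_set_scope.
Local Open Scope ring_scope.

(* The canonical norm of 'M[R]_(m, n) is the sup norm of the entries, so the
   Euclidean norm and the operator norm it induces are introduced here; the
   former generates the canonical topology, hence derivatives below agree. *)
Definition enorm (R : realType) (n : nat) (v : 'cV[R]_n) : R :=
  Num.sqrt (\sum_i v i 0 ^+ 2).

(* The set is nonempty (it contains 0) and bounded, so [sup] is genuine. *)
Definition opnorm (R : realType) (n : nat) (M : 'M[R]_n) : R :=
  sup [set enorm (M *m v) | v in [set v : 'cV[R]_n | enorm v <= 1]].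

(* [d] is the derivative at [t] of [f] seen as a function on [0, +oo[: it is
   two-sided for t > 0 and one-sided at t = 0; values of [f] at negative times
   are irrelevant. *)
Definition has_derivative_ge0 (R : realType) (W : normedModType R)
    (f : R -> W) (t : R) (d : W) : Prop :=
  (s - t)^-1 *: (f s - f t) @[s --> within [set s | 0 <= s] t^'] --> d.

(* V is a (classical) solution on [0, +oo[ of V'(t) = M(t) V(t). *)
Definition is_solution (R : realType) (n : nat) (M : R -> 'M[R]_n)
    (V : R -> 'cV[R]_n) : Prop :=
  forall t, 0 <= t -> has_derivative_ge0 V t (M t *m V t).

(* The relation V(t) = Phi(t,tau) V(tau) for all solutions V characterizes Phi
   only if solutions pass through every state at every time. No regularity is
   imposed on M, so this has to be required explicitly; it is automatic when M
   is continuous. *)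
Definition evolution_operator (R : realType) (n : nat) (M : R -> 'M[R]_n)
    (Phi : R -> R -> 'M[R]_n) : Prop :=
  (forall tau v, 0 <= tau ->
     exists2 V : R -> 'cV[R]_n, is_solution M V & V tau = v) /\
  (forall V, is_solution M V ->
     forall t tau, 0 <= t -> 0 <= tau -> V t = Phi t tau *m V tau).

Definition mu_contractive (R : realType) (n : nat)
    (Phi : R -> R -> 'M[R]_n) (nu : R -> R -> R) : Prop :=
  forall t tau, 0 <= tau -> tau <= t -> opnorm (Phi t tau) <= nu t tau.

(* In the following, [mu a D t tau] stands for mu_{a,D}(t,tau). The value
   a = 0 is included wherever mu_{alpha - delta D, D} has to make sense, since
   alpha - delta D may vanish. *)
Definition mu_positive (R : realType) (mu : R -> R -> R -> R -> R) : Prop :=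
  forall a D t tau, 0 <= a -> 0 < D -> 0 <= t -> 0 <= tau -> 0 < mu a D t tau.

(* Stated for t >= tau >= 0: for t < tau, [mu_B3] makes mu_{a,D}(t,tau)
   increasing in a. Monotonicity is non-strict since mu_{a,D}(tau,tau) = D
   does not depend on a. *)
Definition mu_B1 (R : realType) (mu : R -> R -> R -> R -> R) : Prop :=
  [/\ forall a D tau, 0 < a -> 0 < D -> 0 <= tau ->
        mu a D t tau @[t --> +oo] --> (0 : R),
      forall a D tau t1 t2, 0 < a -> 0 < D -> 0 <= tau ->
        tau <= t1 -> t1 <= t2 -> mu a D t2 tau <= mu a D t1 tau,
      forall a1 a2 D t tau, 0 < a1 -> a1 <= a2 -> 0 < D -> 0 <= tau ->
        tau <= t -> mu a2 D t tau <= mu a1 D t tau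
    & forall a D1 D2 t tau, 0 < a -> 0 < D1 -> D1 <= D2 -> 0 <= tau ->
        tau <= t -> mu a D1 t tau <= mu a D2 t tau].

Definition mu_B2 (R : realType) (mu : R -> R -> R -> R -> R)
    (alpha D tp eps : R) : Prop :=
  exists2 l : R, mu alpha D t 0 @[t --> tp^'+] --> l & l <= eps.

Definition mu_B3 (R : realType) (mu : R -> R -> R -> R -> R) : Prop :=
  [/\ forall a D t tau, 0 <= a -> 0 < D -> 0 <= t -> 0 <= tau ->
        mu a D t tau = D * (mu 1 1 t tau) `^ a,
      forall t tau s, 0 <= t -> 0 <= tau -> 0 <= s ->
        mu 1 1 t tau * mu 1 1 tau s = mu 1 1 t s
    & forall t, 0 <= t ->
        exists2 d : R, has_derivative_ge0 (mu 1 1 0 : R -> R) t d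
                     & 1 <= d * (mu 1 1 0 t)^-1].

(* Main.v *)
Require Import Defs.
From HB Require Import structures.
From mathcomp Require Import all_boot all_order all_algebra.
From mathcomp Require Import all_classical all_reals all_analysis.
From mathcomp Require Import ring lra.

(** Write f t = mu_{1,1}(0,t), so that mu_{a,D}(t,s) = D (f s / f t)^a, and
    w = f^alpha. The textbook argument feeds the variation of constants formula
    into Gronwall's inequality, but here the coefficients may be so irregular
    that no integral makes sense: solutions are merely differentiable. The
    proof therefore works with one-sided growth rates only.

    The hypothesis on Phi says that w r |Phi(r,s) v| <= D w s |v| for s <= r.
    Hence N(s,v), the supremum over r >= s of w r |Phi(r,s) v|
    ([future_norm]), satisfies w s |v| <= N(s,v) <= D w s |v| and does not
    increase along unperturbed orbits. Let V solve the perturbed system and let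
    p s = N(s, V s). At a time x, V has the same value as some unperturbed
    solution U, and V - U has derivative At x V x there; since N grows only
    through the defect V - U ([future_norm_step]), the right upper Dini
    derivative of p at x is at most
      D w x |At x V x| <= D delta w x |V x| <= D delta p x.
    A Gronwall inequality for Dini derivatives ([dini_gronwall]), proved by
    induction along the real interval, gives
      w t |V t| <= p t <= p s exp(D delta (t - s))
                <= D w s |V s| exp(D delta (t - s)),
    which is [perturbed_growth].

    Finally f' / f >= 1 yields exp(t - s) <= f t / f s ([expR_le_rate]), so the
    exponential is at most (f t / f s)^(delta D): the perturbation lowers the
    exponent alpha of f s / f t by delta D. *)

Set Implicit Arguments.
Unset Strict Implicit.
Unset Printing Implicit Defensive.

Import Order.TTheory GRing.Theory Num.Theory.
Import numFieldNormedType.Exports.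

Local Open Scope classical_set_scope.
Local Open Scope ring_scope.

(** * The Euclidean norm and the induced operator norm *)

Lemma enorm_ge0 (R : realType) (n : nat) (v : 'cV[R]_n) : 0 <= enorm v.
Proof. exact: sqrtr_ge0. Qed.

Lemma enorm_sqr (R : realType) (n : nat) (v : 'cV[R]_n) :
  enorm v ^+ 2 = \sum_i v i 0 ^+ 2.
Proof. by rewrite sqr_sqrtr // sumr_ge0 // => i _; exact: sqr_ge0. Qed.

Lemma enorm0 (R : realType) (n : nat) : enorm (0 : 'cV[R]_n) = 0.
Proof.
by rewrite /enorm big1 ?sqrtr0 // => i _; rewrite mxE expr0n.
Qed.

Lemma enormZ (R : realType) (n : nat) (a : R) (v : 'cV[R]_n) :
  enorm (a *: v) = `|a| * enorm v.
Proof.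
rewrite /enorm -sqrtr_sqr -sqrtrM ?sqr_ge0 // mulr_sumr.
by congr Num.sqrt; apply: eq_bigr => i _; rewrite mxE exprMn.
Qed.

Lemma enormN (R : realType) (n : nat) (v : 'cV[R]_n) : enorm (- v) = enorm v.
Proof. by rewrite -scaleN1r enormZ normrN1 mul1r. Qed.

Lemma enorm_eq0 (R : realType) (n : nat) (v : 'cV[R]_n) :
  enorm v = 0 -> v = 0.
Proof.
move=> v0; apply/matrixP => i j; rewrite ord1 mxE.
have /eqP := enorm_sqr v; rewrite v0 expr0n /= eq_sym psumr_eq0; last first.
  by move=> k _; exact: sqr_ge0.
by move=> /allP /(_ i); rewrite mem_index_enum sqrf_eq0 => /(_ isT)/eqP.
Qed.

(** Cauchy-Schwarz; summing the arithmetic-geometric inequality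
    2 a b u_i v_i <= b^2 u_i^2 + a^2 v_i^2 for a = |u| and b = |v| gives
    2 a b <u, v> <= 2 a^2 b^2. *)
Lemma dot_le_enorm (R : realType) (n : nat) (u v : 'cV[R]_n) :
  \sum_i u i 0 * v i 0 <= enorm u * enorm v.
Proof.
have [u0|u0] := eqVneq (enorm u) 0.
  rewrite (enorm_eq0 u0) enorm0 mul0r big1 // => i _.
  by rewrite mxE mul0r.
have [v0|v0] := eqVneq (enorm v) 0.
  rewrite (enorm_eq0 v0) enorm0 mulr0 big1 // => i _.
  by rewrite mxE mulr0.
have a_gt0 : 0 < enorm u by rewrite lt0r u0 enorm_ge0.
have b_gt0 : 0 < enorm v by rewrite lt0r v0 enorm_ge0.
have ab_gt0 : 0 < 2 * (enorm u * enorm v) by rewrite !mulr_gt0.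
rewrite -(ler_pM2l ab_gt0).
have -> : 2 * (enorm u * enorm v) * (enorm u * enorm v) =
    enorm v ^+ 2 * enorm u ^+ 2 + enorm u ^+ 2 * enorm v ^+ 2 by ring.
rewrite [X in _ * X + _]enorm_sqr [X in _ + _ * X]enorm_sqr.
rewrite !mulr_sumr -big_split /=; apply: ler_sum => i _.
rewrite -subr_ge0.
have -> : enorm v ^+ 2 * u i 0 ^+ 2 + enorm u ^+ 2 * v i 0 ^+ 2 -
    2 * (enorm u * enorm v) * (u i 0 * v i 0) =
    (enorm v * u i 0 - enorm u * v i 0) ^+ 2 by ring.
exact: sqr_ge0.
Qed.

Lemma enormD (R : realType) (n : nat) (u v : 'cV[R]_n) :
  enorm (u + v) <= enorm u + enorm v.
Proof.
rewrite -(ler_pXn2r (n := 2)) ?nnegrE ?addr_ge0 ?enorm_ge0 //.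
rewrite sqrrD !enorm_sqr.
have -> : \sum_i (u + v) i 0 ^+ 2 =
    \sum_i u i 0 ^+ 2 + (\sum_i u i 0 * v i 0) *+ 2 + \sum_i v i 0 ^+ 2.
  rewrite -sumrMnl -!big_split /=; apply: eq_bigr => i _.
  by rewrite mxE sqrrD.
by rewrite lerD2r lerD2l lerMn2r dot_le_enorm orbT.
Qed.

Lemma enorm_le_sum (R : realType) (n : nat) (v : 'cV[R]_n) :
  enorm v <= \sum_i `|v i 0|.
Proof.
have s_ge0 : 0 <= \sum_i `|v i 0| by rewrite sumr_ge0.
rewrite -(ler_pXn2r (n := 2)) ?nnegrE ?enorm_ge0 // enorm_sqr expr2 mulr_suml.
apply: ler_sum => i _; rewrite -real_normK ?num_real // expr2 ler_wpM2l //.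
by rewrite (bigD1 i) //= lerDl sumr_ge0.
Qed.

Lemma abs_le_enorm (R : realType) (n : nat) (v : 'cV[R]_n) i :
  `|v i 0| <= enorm v.
Proof.
rewrite -(ler_pXn2r (n := 2)) ?nnegrE ?enorm_ge0 //.
rewrite enorm_sqr real_normK ?num_real // (bigD1 i) //= lerDl.
by rewrite sumr_ge0 // => j _; exact: sqr_ge0.
Qed.

Lemma enorm_cvg (R : realType) (n : nat) (T : Type) (F : set_system T)
    (FF : Filter F) (f : T -> 'cV[R]_n) (l : 'cV[R]_n) :
  f @ F --> l -> enorm (f x) @[x --> F] --> enorm l.
Proof.
move=> fl.
(* The Euclidean norm is at most n times the sup norm. *)
have dist_le (u : 'cV[R]_n) : enorm u <= n%:R * `|u|.
  rewrite (le_trans (enorm_le_sum _)) //.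
  rewrite (_ : n%:R * `|u| = \sum_(i < n) `|u|); last first.
    by rewrite sumr_const card_ord mulr_natl.
  apply: ler_sum => i _.
  by rewrite [leRHS]/Num.norm /= mx_normrE (le_bigmax _ _ (i, 0)).
have dist0 : n%:R * `|f x - l| @[x --> F] --> 0.
  rewrite -(mulr0 n%:R); apply: cvgM; first exact: cvg_cst.
  by apply/norm_cvg0P; apply/subr_cvg0.
apply/subr_cvg0; apply/norm_cvg0P.
apply: (squeeze_cvgr _ (cvg_cst 0) dist0); near=> x.
rewrite normr_ge0 /= (le_trans _ (dist_le _)) // ler_norml.
have := enormD (f x - l) l; have := enormD (l - f x) (f x).
rewrite !subrK -(enormN (l - f x)) opprB => h1 h2.
apply/andP; split; lra.
Unshelve. all: by end_near.
Qed.

Lemma opnorm_has_sup (R : realType) (n : nat) (M : 'M[R]_n) :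
  has_sup [set enorm (M *m v) | v in [set v : 'cV[R]_n | enorm v <= 1]].
Proof.
split; first by exists (enorm (M *m 0)), 0 => //=; rewrite enorm0.
exists (\sum_i \sum_j `|M i j|) => _ [v v1 <-].
rewrite (le_trans (enorm_le_sum _)) //; apply: ler_sum => i _.
rewrite mxE (le_trans (ler_norm_sum _ _ _)) //; apply: ler_sum => j _.
by rewrite normrM ler_piMr // (le_trans (abs_le_enorm _ _)).
Qed.

Lemma opnorm_ge0 (R : realType) (n : nat) (M : 'M[R]_n) : 0 <= opnorm M.
Proof.
apply: (ub_le_sup (opnorm_has_sup M).2).
by exists 0; rewrite /= ?mulmx0 enorm0.
Qed.

Lemma enorm_mulmx (R : realType) (n : nat) (M : 'M[R]_n) (v : 'cV[R]_n) :
  enorm (M *m v) <= opnorm M * enorm v.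
Proof.
have [v0|v0] := eqVneq (enorm v) 0.
  by rewrite v0 (enorm_eq0 v0) mulmx0 enorm0 mulr0.
have v_gt0 : 0 < enorm v by rewrite lt0r v0 enorm_ge0.
rewrite -ler_pdivrMr // mulrC.
apply: (ub_le_sup (opnorm_has_sup M).2).
have nV : `|(enorm v)^-1| = (enorm v)^-1 by rewrite gtr0_norm ?invr_gt0.
by exists ((enorm v)^-1 *: v); rewrite /= ?linearZ /= enormZ nV ?mulVf.
Qed.

Lemma opnorm_le (R : realType) (n : nat) (M : 'M[R]_n) (c : R) :
  0 <= c -> (forall v, enorm (M *m v) <= c * enorm v) -> opnorm M <= c.
Proof.
move=> c_ge0 Mc; apply: ge_sup; first exact: (opnorm_has_sup M).1.
by move=> _ [v v1 <-]; rewrite (le_trans (Mc v)) // ler_piMr.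
Qed.

(** * A Gronwall inequality for Dini derivatives *)

(** Otherwise the supremum of the points up to which [P] holds would satisfy [P]
    by the step to the left, and then would be exceeded by the step to the
    right. *)
Lemma real_induction (R : realType) (a b : R) (P : R -> Prop) :
  a <= b -> P a ->
  (forall x, a <= x -> x < b -> P x -> \forall y \near x^'+, P y) ->
  (forall x, a < x -> x <= b -> (forall y, a <= y -> y < x -> P y) -> P x) ->
  P b.
Proof.
move=> ab Pa stepr stepl.
pose S := [set x | [/\ a <= x, x <= b & forall y, a <= y -> y <= x -> P y]].
have Sa : S a.
  by split=> // y ay ya; rewrite (_ : y = a) //; apply/le_anti/andP.
have Sub : ubound S b by move=> x [].
have supS : has_sup S by split; [exists a | exists b].
have aS : a <= sup S by apply: ub_le_sup => //; exact: supS.2.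
have Sb : sup S <= b by apply: ge_sup => //; exact: supS.1.
have belowS y : a <= y -> y < sup S -> P y.
  move=> ay yS.
  have [x [ax xb Px]] := sup_adherent (etrans (subr_gt0 _ _) yS) supS.
  by rewrite subKr => yx; apply: Px => //; exact: ltW.
have PS : P (sup S).
  have [<-//|aS'] := eqVneq a (sup S).
  by apply: stepl => //; rewrite lt_neqAle aS'.
have [<-//|Sb'] := eqVneq (sup S) b.
have {}Sb' : sup S < b by rewrite lt_neqAle Sb'.
have /nbhs_ballP[e /= e_gt0 Pe] := stepr _ aS Sb' PS.
(* A point of S strictly above its supremum. *)
pose x := Num.min b (sup S + e / 2).
have Sx : S x.
  split; first by rewrite le_min ab; lra.
    by rewrite ge_min lexx.
  move=> y ay; rewrite le_min => /andP[yb ye].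
  have [yS|Sy|->//] := ltgtP y (sup S); first exact: belowS.
  by apply: Pe => //; rewrite /ball /= ltr0_norm; lra.
have : x <= sup S by apply: ub_le_sup => //; exact: supS.2.
by rewrite ge_min !leNgt Sb' /=; case: ltP => //; lra.
Qed.

(** The last two hypotheses say that the right upper Dini derivative of h is at
    most c h and that h has no upward jump from the left. For every e > 0, the
    slack e (x - a) in the strict supersolution
    (h a + e (x - a)) exp(c (x - a)) lets the bound by it propagate a little to
    the right of any point where it holds, and the absence of upward jumps lets
    it pass to limits from the left. *)
Lemma dini_gronwall (R : realType) (a b c : R) (h : R -> R) :
  a <= b -> (forall x, a <= x -> x <= b -> 0 <= h x) ->
  (forall x, a <= x -> x < b -> forall e, 0 < e ->
     \forall y \near x^'+, h y <= h x + (y - x) * (c * h x + e)) ->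
  (forall x, a < x -> x <= b -> forall e, 0 < e ->
     \forall y \near x^'-, h x <= h y + e) ->
  h b <= h a * expR (c * (b - a)).
Proof.
move=> ab h_ge0 hr hl.
pose phi e x := (h a + e * (x - a)) * expR (c * (x - a)).
have phi_cts e x : phi e y @[y --> x^'-] --> phi e x.
  apply: cvg_at_left_filter; apply: cvgM.
    apply: cvgD; first exact: cvg_cst.
    apply: cvgM; first exact: cvg_cst.
    by apply: cvgB; [exact: cvg_id | exact: cvg_cst].
  apply: continuous_cvg; first exact: continuous_expR.
  apply: cvgM; first exact: cvg_cst.
  by apply: cvgB; [exact: cvg_id | exact: cvg_cst].
have below e : 0 < e -> h b <= phi e b.
  move=> e_gt0; apply: (real_induction (P := fun x => h x <= phi e x) ab).
  - by rewrite /phi subrr !mulr0 addr0 expR0 mulr1.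
  - move=> x ax xb hx.
    (* A lower bound of exp(c (y - a)) uniform in y, so that the slack
       available at every y is at least e * m per unit of time. *)
    pose m := expR (- `|c| * (b - a)).
    have em_gt0 : 0 < e * m by rewrite mulr_gt0 // expR_gt0.
    near=> y.
    have xy : x < y by near: y; exact: nbhs_right_gt.
    have yb : y <= b by near: y; exact: nbhs_right_le.
    have : h y <= h x + (y - x) * (c * h x + e * m).
      by near: y; exact: hr.
    move=> /le_trans; apply.
    have hx_exp : h x * (1 + c * (y - x)) <=
        (h a + e * (x - a)) * expR (c * (y - a)).
      rewrite (_ : c * (y - a) = c * (x - a) + c * (y - x)); last by ring.
      rewrite expRD mulrA; apply: (@le_trans _ _ (h x * expR (c * (y - x)))).
        apply: ler_wpM2l; last exact: expR_ge1Dx.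
        by apply: h_ge0 => //; exact: ltW.
      by rewrite ler_pM2r ?expR_gt0.
    have m_le : m <= expR (c * (y - a)).
      rewrite ler_expR; apply: (@le_trans _ _ (- `|c| * (y - a))).
        by rewrite !mulNr lerN2 ler_wpM2l // lerB.
      by apply: ler_wpM2r; [lra | rewrite lerNl ler_normr lexx orbT].
    have step : (y - x) * (e * m) <= e * (y - x) * expR (c * (y - a)).
      rewrite mulrA (mulrC (y - x)) ler_wpM2l //.
      by rewrite mulr_ge0; lra.
    rewrite /phi; move: hx_exp step; lra.
  - move=> x ax xb hx; apply/ler_addgt0Pr => d d_gt0.
    have d2_gt0 : 0 < d / 2 by lra.
    have {}hl := hl x ax xb _ d2_gt0.
    near x^'- => y.
    have ay : a < y by near: y; exact: nbhs_left_gt.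
    have yx : y < x by near: y; exact: nbhs_left_lt.
    have h1 : h x <= h y + d / 2 by near: y.
    have h2 : phi e y <= phi e x + d / 2.
      by near: y; apply: (cvgr_le _ (phi_cts e x)); lra.
    have := hx y (ltW ay) yx; move: h1 h2; lra.
apply/ler_addgt0Pr => e e_gt0.
pose K := (b - a) * expR (c * (b - a)).
have K_ge0 : 0 <= K by rewrite mulr_ge0 ?expR_ge0 //; lra.
have K1_gt0 : 0 < K + 1 by lra.
have := below (e / (K + 1)) (divr_gt0 e_gt0 K1_gt0).
move=> /le_trans; apply.
rewrite /phi mulrDl lerD2l -mulrA -/K mulrAC ler_pdivrMr //.
by rewrite ler_pM2l //; lra.
Unshelve. all: by end_near.
Qed.

(** * One-sided limits *)

Lemma right_within_ge0 (R : realType) (t : R) : 0 <= t ->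
  t^'+ `=>` within [set s | 0 <= s] t^'.
Proof.
move=> t_ge0 P /= [e e_gt0 Pe]; exists e => // s /Pe /= Ps ts.
by apply: Ps; [rewrite gt_eqF | rewrite (le_trans t_ge0) // ltW].
Qed.

Lemma left_within_ge0 (R : realType) (t : R) : 0 < t ->
  t^'- `=>` within [set s | 0 <= s] t^'.
Proof.
move=> t_gt0 P [e /= e_gt0 Pe]; near=> s; apply: (Pe s).
- near: s; apply: cvg_within; exact: nbhsx_ballx.
- by rewrite lt_eqF //; near: s; exact: nbhs_left_lt.
- by near: s; exact: nbhs_left_ge.
Unshelve. all: by end_near.
Qed.

Lemma has_derivative_ge0_cts (R : realType) (W : normedModType R)
    (f : R -> W) (t : R) (d : W) : has_derivative_ge0 f t d ->
  f s @[s --> within [set s | 0 <= s] t^'] --> f t.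
Proof.
move=> fd; apply/subr_cvg0; rewrite -(scale0r d).
have st : s - t @[s --> within [set s | 0 <= s] t^'] --> 0.
  apply/subr_cvg0; apply: cvg_within_filter; apply: cvg_within_filter.
  exact: cvg_id.
apply: cvg_trans (cvgZ st fd); apply: near_eq_cvg.
near=> s; rewrite /= scalerA divff ?scale1r // subr_eq0.
near: s; apply: cvg_within; exact: withinT.
Unshelve. all: by end_near.
Qed.

Lemma cvg_powR (R : realType) (f : R -> R) (a : R) (F : set_system R)
    (FF : Filter F) (l : R) : 0 < l ->
  f s @[s --> F] --> l -> f s `^ a @[s --> F] --> l `^ a.
Proof.
move=> l_gt0; apply: (@continuous_cvg _ _ _ _ _ f (fun x => x `^ a)) => /=.
apply: differentiable_continuous; apply/derivable1_diffP.
by apply: derivable_powR; rewrite in_itv /= l_gt0.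
Qed.

(** * A Lyapunov norm for the unperturbed evolution *)

Lemma evol_id (R : realType) (n : nat) (M : R -> 'M[R]_n)
    (Phi : R -> R -> 'M[R]_n) (s : R) (v : 'cV[R]_n) :
  evolution_operator M Phi -> 0 <= s -> Phi s s *m v = v.
Proof.
by move=> [ex PhiE] s_ge0; have [V /PhiE VE <-] := ex s v s_ge0; rewrite -VE.
Qed.

Lemma evol_comp (R : realType) (n : nat) (M : R -> 'M[R]_n)
    (Phi : R -> R -> 'M[R]_n) (r s q : R) (v : 'cV[R]_n) :
  evolution_operator M Phi -> 0 <= r -> 0 <= s -> 0 <= q ->
  Phi r s *m (Phi s q *m v) = Phi r q *m v.
Proof.
move=> [ex PhiE] r_ge0 s_ge0 q_ge0; have [V /PhiE VE <-] := ex q v q_ge0.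
by rewrite -!VE.
Qed.

(** Bounding the weighted operator norms says exactly that this supremum over
    the future orbit is a norm in [v], equivalent to [w s * enorm v] with
    constant [D]. Its point is that, unlike [w s * enorm v] itself, it does not
    increase along the orbits of [Phi]: the constant [D] is paid only once. *)
Definition future_norm (R : realType) (n : nat) (Phi : R -> R -> 'M[R]_n)
    (w : R -> R) (s : R) (v : 'cV[R]_n) : R :=
  sup [set w r * enorm (Phi r s *m v) | r in [set r | s <= r]].

Definition weighted_bound (R : realType) (n : nat) (Phi : R -> R -> 'M[R]_n)
    (w : R -> R) (D : R) : Prop :=
  forall r s v, 0 <= s -> s <= r ->
    w r * enorm (Phi r s *m v) <= D * w s * enorm v.

Section FutureNorm.
Context (R : realType) (n : nat) (M : R -> 'M[R]_n) (Phi : R -> R -> 'M[R]_n)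
  (w : R -> R) (D : R).
Hypothesis evolPhi : evolution_operator M Phi.
Hypothesis boundPhi : weighted_bound Phi w D.
Hypothesis w_ge0 : forall t, 0 <= t -> 0 <= w t.

Let N := future_norm Phi w.

Lemma future_norm_ge s r v : 0 <= s -> s <= r ->
  w r * enorm (Phi r s *m v) <= N s v.
Proof.
move=> s_ge0 sr; apply: ub_le_sup; last by exists r.
by exists (D * w s * enorm v) => _ [q sq <-]; exact: boundPhi.
Qed.

Lemma future_norm_leP s v c : 0 <= s ->
  (forall r, s <= r -> w r * enorm (Phi r s *m v) <= c) -> N s v <= c.
Proof.
move=> s_ge0 le_c; apply: ge_sup.
  by exists (w s * enorm (Phi s s *m v)); exists s => /=.
by move=> _ [r sr <-]; exact: le_c.
Qed.

Lemma future_norm_ge_enorm s v : 0 <= s -> w s * enorm v <= N s v.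
Proof.
by move=> s_ge0; rewrite -{1}(evol_id v evolPhi s_ge0) future_norm_ge.
Qed.

Lemma future_norm_le_enorm s v : 0 <= s -> N s v <= D * w s * enorm v.
Proof. by move=> s_ge0; apply: future_norm_leP => // r; exact: boundPhi. Qed.

Lemma future_normD s u v : 0 <= s -> N s (u + v) <= N s u + N s v.
Proof.
move=> s_ge0; apply: future_norm_leP => // r sr.
apply: (@le_trans _ _ (w r * (enorm (Phi r s *m u) + enorm (Phi r s *m v)))).
  by rewrite ler_wpM2l ?w_ge0 ?(le_trans s_ge0) // mulmxDr enormD.
by rewrite mulrDr lerD // future_norm_ge.
Qed.

Lemma future_norm_evol s t v : 0 <= s -> s <= t ->
  N t (Phi t s *m v) <= N s v.
Proof.
move=> s_ge0 st; have t_ge0 := le_trans s_ge0 st.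
apply: future_norm_leP => // r tr; have r_ge0 := le_trans t_ge0 tr.
by rewrite (evol_comp _ evolPhi) // future_norm_ge // (le_trans st).
Qed.

(** The norm of a state can grow only by the defect between the state and the
    unperturbed orbit. *)
Lemma future_norm_step s t u v : 0 <= s -> s <= t ->
  N t u <= N s v + D * w t * enorm (u - Phi t s *m v).
Proof.
move=> s_ge0 st; have t_ge0 := le_trans s_ge0 st.
rewrite -{1}(subrKC (Phi t s *m v) u).
rewrite (le_trans (future_normD _ _ t_ge0)) // lerD ?future_norm_evol //.
exact: future_norm_le_enorm.
Qed.

End FutureNorm.

(** * Growth of the solutions of the perturbed system *)

(** Roughness with an arbitrary weight [w], hence for systems that need not
    contract. At time t, compare V with the unperturbed solution U that passes
    through the same state: V - U has derivative [B t *m V t] there, so the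
    future norm of V grows at rate at most [D * delta]. *)
Lemma perturbed_growth (R : realType) (n : nat) (M B : R -> 'M[R]_n)
    (Phi : R -> R -> 'M[R]_n) (w : R -> R) (D delta : R) (V : R -> 'cV[R]_n) :
  evolution_operator M Phi -> weighted_bound Phi w D -> 0 <= D ->
  (forall t, 0 <= t -> 0 <= w t) ->
  (forall t : R, 0 <= t -> w s @[s --> within [set s | 0 <= s] t^'] --> w t) ->
  (forall t, 0 <= t -> opnorm (B t) <= delta) ->
  is_solution (fun t => M t + B t) V ->
  forall tau t, 0 <= tau -> tau <= t ->
  w t * enorm (V t) <= D * w tau * enorm (V tau) * expR (D * delta * (t - tau)).
Proof.
move=> evolPhi boundPhi D_ge0 w_ge0 w_cts B_le solV tau t tau_ge0 tau_t.
have t_ge0 := le_trans tau_ge0 tau_t.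
pose p s := future_norm Phi w s (V s).
have p_ge s : 0 <= s -> w s * enorm (V s) <= p s.
  exact: (future_norm_ge_enorm evolPhi boundPhi).
apply: (le_trans (p_ge t t_ge0)).
apply: (@le_trans _ _ (p tau * expR (D * delta * (t - tau)))); last first.
  by rewrite ler_pM2r ?expR_gt0 // (future_norm_le_enorm boundPhi).
(* The unperturbed solution through V x at time x. *)
have osculating x : 0 <= x -> exists2 U, is_solution M U &
    U x = V x /\ forall s, 0 <= s -> Phi s x *m V x = U s.
  move=> x_ge0; have [U solU Ux] := evolPhi.1 x (V x) x_ge0.
  exists U => //; split=> // s s_ge0.
  by rewrite -Ux -(evolPhi.2 U solU).
apply: dini_gronwall => // [x tau_x xt|x tau_x xt e e_gt0|x tau_x xt e e_gt0].
- have x_ge0 := le_trans tau_ge0 tau_x.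
  by rewrite (le_trans _ (p_ge x x_ge0)) // mulr_ge0 ?w_ge0 ?enorm_ge0.
- have x_ge0 := le_trans tau_ge0 tau_x.
  have [U solU [Ux UE]] := osculating x x_ge0.
  pose q s := (s - x)^-1 *: (V s - V x) - (s - x)^-1 *: (U s - U x).
  have q_cvg : D * w s * enorm (q s) @[s --> x^'+] -->
      D * w x * enorm (B x *m V x).
    apply: cvgM.
      apply: cvgM; first exact: cvg_cst.
      exact: cvg_trans (cvg_app _ (right_within_ge0 x_ge0)) (w_cts x x_ge0).
    apply: enorm_cvg.
    have -> : B x *m V x = (M x + B x) *m V x - M x *m U x.
      by rewrite Ux mulmxDl addrC addKr.
    apply: cvgB.
      exact: cvg_trans (cvg_app _ (right_within_ge0 x_ge0)) (solV x x_ge0).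
    exact: cvg_trans (cvg_app _ (right_within_ge0 x_ge0)) (solU x x_ge0).
  have lim_lt : D * w x * enorm (B x *m V x) < D * delta * p x + e.
    apply: (@le_lt_trans _ _ (D * delta * p x)); last by rewrite ltrDl.
    rewrite -!mulrA ler_wpM2l //.
    have delta_ge0 : 0 <= delta := le_trans (opnorm_ge0 (B x)) (B_le x x_ge0).
    apply: (@le_trans _ _ (w x * (delta * enorm (V x)))).
      rewrite ler_wpM2l ?w_ge0 // (le_trans (enorm_mulmx _ _)) //.
      by rewrite ler_wpM2r ?enorm_ge0 ?B_le.
    by rewrite mulrCA ler_wpM2l // p_ge.
  near=> s.
  have xs : x < s by near: s; exact: nbhs_right_gt.
  have s_ge0 : 0 <= s by rewrite (le_trans x_ge0) ?ltW.
  have qs : D * w s * enorm (q s) <= D * delta * p x + e.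
    by near: s; apply: (cvgr_le _ q_cvg).
  have := future_norm_step evolPhi boundPhi w_ge0 (V s) (V x) x_ge0 (ltW xs).
  move=> /le_trans; apply; rewrite lerD2l UE //.
  have sx_gt0 : 0 < s - x by rewrite subr_gt0.
  have -> : V s - U s = (s - x) *: q s.
    rewrite /q -scalerBr scalerA divff ?gt_eqF // scale1r Ux.
    by rewrite opprB addrA subrK.
  by rewrite enormZ gtr0_norm // mulrCA ler_wpM2l // ltW.
- have x_gt0 := le_lt_trans tau_ge0 tau_x; have x_ge0 := ltW x_gt0.
  have [U solU [Ux UE]] := osculating x x_ge0.
  have d_cvg : D * (D * w s * enorm (U s - V s)) @[s --> x^'-] --> 0.
    have -> : 0 = D * (D * w x * enorm (U x - V x)).
      by rewrite Ux subrr enorm0 !mulr0.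
    apply: cvgM; first exact: cvg_cst.
    apply: cvgM.
      apply: cvgM; first exact: cvg_cst.
      exact: cvg_trans (cvg_app _ (left_within_ge0 x_gt0)) (w_cts x x_ge0).
    apply: enorm_cvg; apply: cvgB.
      exact: cvg_trans (cvg_app _ (left_within_ge0 x_gt0))
        (has_derivative_ge0_cts (solU x x_ge0)).
    exact: cvg_trans (cvg_app _ (left_within_ge0 x_gt0))
      (has_derivative_ge0_cts (solV x x_ge0)).
  near=> s.
  have sx : s < x by near: s; exact: nbhs_left_lt.
  have s_ge0 : 0 <= s by near: s; exact: nbhs_left_ge.
  have ds : D * (D * w s * enorm (U s - V s)) <= e.
    by near: s; apply: (cvgr_le _ d_cvg).
  have := future_norm_step evolPhi boundPhi w_ge0 (V x) (V s) s_ge0 (ltW sx).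
  move=> /le_trans; apply; rewrite lerD2l (le_trans _ ds) // -mulrA.
  rewrite ler_wpM2l //.
  (* The defect at x is the image under [Phi x s] of the defect at s. *)
  have -> : V x - Phi x s *m V s = Phi x s *m (U s - V s).
    by rewrite mulmxBr -UE // (evol_comp _ evolPhi) // (evol_id _ evolPhi).
  by apply: boundPhi => //; exact: ltW.
Unshelve. all: by end_near.
Qed.

(** * The rate function *)

Section Rate.
Context (R : realType) (mu : R -> R -> R -> R -> R).
Hypothesis mu_pos : mu_positive mu.
Hypothesis B3 : mu_B3 mu.

Let f := mu 1 1 0.

Let f_gt0 (t : R) : 0 <= t -> 0 < f t.
Proof. by move=> t_ge0; apply: mu_pos. Qed.

Lemma rate_ratio (t tau : R) : 0 <= t -> 0 <= tau ->
  mu 1 1 t tau = mu 1 1 0 tau / mu 1 1 0 t.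
Proof.
move=> t_ge0 tau_ge0; have [_ muM _] := B3.
have mu_gt0 (a b : R) : 0 <= a -> 0 <= b -> 0 < mu 1 1 a b.
  by move=> *; exact: mu_pos.
rewrite -(muM 0 t tau) // mulrAC divff ?mul1r //.
by rewrite gt_eqF ?mu_gt0.
Qed.

Lemma rate_cts (t : R) : 0 <= t ->
  mu 1 1 0 s @[s --> within [set s | 0 <= s] t^'] --> mu 1 1 0 t.
Proof.
move=> t_ge0; have [_ _ /(_ t t_ge0)[d fd _]] := B3.
exact: (has_derivative_ge0_cts fd).
Qed.

(** The logarithmic derivative of [mu 1 1 0] is at least 1; in terms of the
    nonnegative function [1 / mu 1 1 0], its derivative is at most its
    opposite. *)
Lemma expR_le_rate (t tau : R) : 0 <= tau -> tau <= t ->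
  expR (t - tau) <= mu 1 1 0 t / mu 1 1 0 tau.
Proof.
move=> tau_ge0 tau_t; have t_ge0 := le_trans tau_ge0 tau_t.
have fV_gt0 (x : R) : 0 <= x -> 0 < (f x)^-1.
  by move=> x_ge0; rewrite invr_gt0 f_gt0.
have fV_cts (x : R) : 0 <= x ->
    (f s)^-1 @[s --> within [set s | 0 <= s] x^'] --> (f x)^-1.
  by move=> x_ge0; apply: cvgV (rate_cts x_ge0); rewrite gt_eqF ?f_gt0.
have decay : (f t)^-1 <= (f tau)^-1 * expR (-1 * (t - tau)).
  apply: (dini_gronwall (h := fun x => (f x)^-1)) => //.
  - by move=> x tau_x _; rewrite ltW ?fV_gt0 ?(le_trans tau_ge0).
  - move=> x tau_x xt e e_gt0; have x_ge0 := le_trans tau_ge0 tau_x.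
    have [_ _ /(_ x x_ge0)[d fd d_ge]] := B3.
    have q_cvg : - ((s - x)^-1 *: (f s - f x)) * ((f s)^-1 * (f x)^-1)
        @[s --> x^'+] --> - d * ((f x)^-1 * (f x)^-1).
      apply: cvgM.
        apply: cvgN.
        exact: cvg_trans (cvg_app _ (right_within_ge0 x_ge0)) fd.
      apply: cvgM; last exact: cvg_cst.
      exact: cvg_trans (cvg_app _ (right_within_ge0 x_ge0)) (fV_cts x x_ge0).
    (* The limit is -(f'/f)(1/f) <= -1/f, as f'/f >= 1. *)
    have lim_lt : - d * ((f x)^-1 * (f x)^-1) < -1 * (f x)^-1 + e.
      have := fV_gt0 x x_ge0; rewrite -/f in d_ge; move: d_ge.
      by set g := (f x)^-1 => d_ge g_gt0; nra.
    near=> s.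
    have xs : x < s by near: s; exact: nbhs_right_gt.
    have s_ge0 : 0 <= s by rewrite (le_trans x_ge0) ?ltW.
    have qs : - ((s - x)^-1 *: (f s - f x)) * ((f s)^-1 * (f x)^-1) <=
        -1 * (f x)^-1 + e by near: s; apply: (cvgr_le _ q_cvg).
    have sx_gt0 : 0 < s - x by rewrite subr_gt0.
    rewrite -lerBlDl; apply: le_trans (ler_wpM2l (ltW sx_gt0) qs).
    rewrite le_eqVlt; apply/orP; left; apply/eqP.
    rewrite /GRing.scale /=; field.
    by rewrite !gt_eqF ?f_gt0.
  - move=> x tau_x xt e e_gt0; have x_gt0 := le_lt_trans tau_ge0 tau_x.
    have := cvg_trans (cvg_app _ (left_within_ge0 x_gt0))
      (fV_cts x (ltW x_gt0)).
    move=> fl; near=> s.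
    rewrite -lerBlDr; near: s; apply: (cvgr_ge _ fl).
    by rewrite ltrBlDr ltrDl.
move: decay; rewrite mulN1r expRN -invfM.
rewrite lef_pV2 ?posrE ?mulr_gt0 ?expR_gt0 //.
- by rewrite ler_pdivlMr ?(f_gt0 tau_ge0) // mulrC.
- exact: f_gt0.
- exact: f_gt0.
Unshelve. all: by end_near.
Qed.

End Rate.

(** * The contraction estimate *)

Theorem theorem2 (R : realType) (n : nat) (tp alpha D delta eps : R)
    (mu : R -> R -> R -> R -> R)
    (A : R -> R -> 'M[R]_n) (At : R -> 'M[R]_n)
    (Phi Gamma : R -> R -> 'M[R]_n)
    (tp_gt0 : 0 < tp) (alpha_gt0 : 0 < alpha) (D_gt0 : 0 < D)
    (eps_gt0 : 0 < eps)
    (mu_pos : mu_positive mu)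
    (B1 : mu_B1 mu) (B2 : mu_B2 mu alpha D tp eps) (B3 : mu_B3 mu)
    (evolPhi : evolution_operator (fun t => - A t tp) Phi)
    (contrPhi : mu_contractive Phi (mu alpha D))
    (At_le : forall t, 0 <= t -> opnorm (At t) <= delta)
    (delta_le : delta <= alpha / D)
    (evolGamma : evolution_operator (fun t => - A t tp + At t) Gamma) :
  mu_contractive Gamma (mu (alpha - delta * D) D).
Proof.
have [muE _ _] := B3.
pose f := mu 1 1 0; pose w (s : R) := f s `^ alpha.
have f_gt0 (t : R) : 0 <= t -> 0 < f t by move=> t_ge0; exact: mu_pos.
have delta_ge0 : 0 <= delta := le_trans (opnorm_ge0 (At 0)) (At_le 0 (lexx 0)).
have dD_le : delta * D <= alpha by rewrite -ler_pdivlMr.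
have exponent_ge0 : 0 <= alpha - delta * D by rewrite subr_ge0.
have w_bound : weighted_bound Phi w D.
  move=> r s v s_ge0 sr; have r_ge0 := le_trans s_ge0 sr.
  have -> : w s = w r * (mu 1 1 r s) `^ alpha.
    rewrite (rate_ratio mu_pos B3) // /w -powRM ?divr_ge0 ?ltW ?f_gt0 //.
    by rewrite mulrC divfK // gt_eqF ?f_gt0.
  rewrite mulrCA -mulrA ler_wpM2l ?powR_ge0 // -muE ?(ltW alpha_gt0) //.
  rewrite (le_trans (enorm_mulmx _ _)) // ler_wpM2r ?enorm_ge0 //.
  exact: contrPhi.
have growth V : is_solution (fun t => - A t tp + At t) V ->
    forall tau t : R, 0 <= tau -> tau <= t ->
    w t * enorm (V t) <=
      D * w tau * enorm (V tau) * expR (D * delta * (t - tau)).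
  move=> solV; apply: (perturbed_growth evolPhi w_bound) solV => //.
  - exact: ltW.
  - by move=> t _; exact: powR_ge0.
  - by move=> t t_ge0; apply: cvg_powR; [exact: f_gt0 | exact: rate_cts].
move=> t tau tau_ge0 tau_t; have t_ge0 := le_trans tau_ge0 tau_t.
have ft_gt0 := f_gt0 t t_ge0; have ftau_gt0 := f_gt0 tau tau_ge0.
rewrite muE //; apply: opnorm_le; first by rewrite mulr_ge0 ?powR_ge0 ?ltW.
move=> v; have [V solV Vtau] := evolGamma.1 tau v tau_ge0.
rewrite -Vtau -(evolGamma.2 V solV) //.
have wt_gt0 : 0 < w t by exact: powR_gt0.
rewrite -(ler_pM2l wt_gt0) (le_trans (growth V solV _ _ tau_ge0 tau_t)) //.
(* The gain exp(D delta (t - tau)) is absorbed by a power of the rate. *)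
have gain : expR (D * delta * (t - tau)) <= (f t / f tau) `^ (delta * D).
  rewrite (_ : D * delta * (t - tau) = (t - tau) * (delta * D)); last by ring.
  rewrite expRM.
  apply: (ge0_ler_powR (mulr_ge0 delta_ge0 (ltW D_gt0))).
  - by rewrite nnegrE expR_ge0.
  - by rewrite nnegrE divr_ge0 ?ltW.
  - exact: (expR_le_rate mu_pos B3).
have -> : w t * (D * (mu 1 1 t tau) `^ (alpha - delta * D) * enorm (V tau)) =
    D * w tau * enorm (V tau) * (f t / f tau) `^ (delta * D).
  rewrite (rate_ratio mu_pos B3) // -/f.
  have q_gt0 : 0 < f tau / f t by rewrite divr_gt0.
  rewrite powRB; last by rewrite (gt_eqF q_gt0) implybT.
  have -> : w tau = w t * (f tau / f t) `^ alpha.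
    by rewrite /w -powRM ?ltW // mulrC divfK // gt_eqF.
  have -> : (f t / f tau) `^ (delta * D) = ((f tau / f t) `^ (delta * D))^-1.
    rewrite -[f t / f tau]invf_div -(powR_inv1 (ltW q_gt0)).
    by rewrite -powRrM mulN1r powRN.
  by ring.
by rewrite ler_wpM2l // !mulr_ge0 ?enorm_ge0 ?powR_ge0 ?ltW.
Qed.
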